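(* Fix an integer $d\ge 2$. For each $n$ let $\mathbf p=\mathbf p(n)=(p_1,\dots,p_d)\in(0,1]^d$. (i) Suppose $\min_{i=1,\dots,d-1}\liminf_{n\to\infty}p_i>0$ and $p_d(n)\gg \frac{\log n}{n}$. Then the multi-parameter random simplicial complex $Y=Y_d(n,\mathbf p)$ almost surely does not contain any maximal $(d-1)$-cells, i.e. $N_{d-1}(Y)\to0$ almost surely as $n\to\infty$. (ii) Suppose $p_d(n)\gg\frac{\log n}{n}$. Then the multi-parameter upper model $Z=Z_d(n,\mathbf p)$ almost surely does not contain any maximal $(d-1)$-cells, i.e. $N_{d-1}(Z)\to0$ almost surely as $n\to\infty$.
   Context: For $f,g:\mathbb N\to\mathbb R$, $f\gg g$ means $g(n)/f(n)\to0$ as $n\to\infty$. Simplicial complexes: a simplicial complex $X$ on a finite vertex set is a collection of subsets closed under taking subsets. A cell $\sigma\in X$ has dimension $|\sigma|-1$; a cell of dimension $j$ is a $j$-cell. A $(d-1)$-cell of $X$ is called maximal if it is not contained in any $d$-cell of $X$; $N_{d-1}(X)$ is the number of maximal $(d-1)$-cells of $X$. Random hypergraph: let $\chi_\tau^{(n)}$, for $\tau\subseteq[n]=\{1,\dots,n\}$ with $2\le|\tau|\le d+1$, be independent Bernoulli random variables with parameter $p_{|\tau|-1}(n)$ (a triangular family of independent random variables over all $n$, on one probability space), and let $\mathcal X(n,\mathbf p)=\{\tau:\chi^{(n)}_\tau=1\}$. Lower model: $Y_d(n,\mathbf p)$ is the set of all $\sigma\subseteq[n]$ with $|\sigma|\le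 d+1$ such that $\tau\in\mathcal X(n,\mathbf p)$ for every $\tau\subseteq\sigma$ with $|\tau|\ge2$. (Equivalently, starting from $n$ vertices, for $k=1,\dots,d$ in turn, every $k$-cell whose boundary is already present is included independently with probability $p_k$.) Upper model: $Z_d(n,\mathbf p)=\bigcup_{\sigma\in\mathcal X(n,\mathbf p)}\{\sigma':\sigma'\subseteq\sigma\}$, the smallest simplicial complex containing $\mathcal X(n,\mathbf p)$. *)

(* Defs.v *)
From HB Require Import structures.
From mathcomp Require Export all_boot all_order all_algebra finmap.
From mathcomp Require Export all_classical all_reals all_analysis.

Set Implicit Arguments.
Unset Strict Implicit.
Unset Printing Implicit Defensive.

Import Order.TTheory GRing.Theory Num.Theory.
Import numFieldNormedType.Exports.

Section complexes.
Local Open Scope set_scope.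
Local Open Scope nat_scope.
Variable V : finType.
Implicit Type X : {set {set V}}.

Definition cells (j : nat) X : {set {set V}} := [set s in X | #|s| == j.+1].

Definition maximal_cells (j : nat) X : {set {set V}} :=
  [set s in cells j X | [forall t in cells j.+1 X, ~~ (s \subset t)]].

Definition num_maximal_cells (j : nat) X : nat := #|maximal_cells j X|.

(* Contains the empty cell and all the vertices, since the condition only
   involves the subsets t with at least two elements. *)
Definition lower_model (d : nat) X : {set {set V}} :=
  [set s : {set V} | (#|s| <= d.+1) &&
    [forall t : {set V}, (t \subset s) && (2 <= #|t|) ==> (t \in X)]].

Definition upper_model X : {set {set V}} := \bigcup_(s in X) powerset s.

End complexes.

Local Open Scope classical_set_scope.
Local Open Scope ring_scope.

(* f >> g, i.e. g = o(f) *)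
Definition dominates (R : realType) (f g : nat -> R) : Prop :=
  g n / f n @[n --> \oo] --> (0 : R).

Definition mutually_independent (disp disp' : measure_display)
    (T : measurableType disp) (T' : measurableType disp') (R : realType)
    (P : probability T R) (I : choiceType) (D : set I)
    (X : I -> {RV P >-> T'}) : Prop :=
  forall (A : {fset I}) (B : I -> set T'),
    [set` A] `<=` D -> (forall i, measurable (B i)) ->
    P (\bigcap_(i in [set` A]) (X i @^-1` B i)) =
    (\prod_(i <- A) P (X i @^-1` B i))%E.

(* The vertex set [n] is 'I_n.  The family chi is given on all subsets of 'I_n,
   but only its members with 2 <= #|tau| <= d.+1 are constrained or used. *)
Section random_complexes.
Variables (disp : measure_display) (T : measurableType disp) (R : realType).
Variables (P : probability T R) (d : nat).
Variable chi : forall n, {set 'I_n} -> {RV P >-> bool}.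

(* p n k is the parameter p_k(n), for 1 <= k <= d.  Independence is over all
   pairs (n, tau), not only for each fixed n. *)
Definition bernoulli_array (p : nat -> nat -> R) : Prop :=
  (forall n (tau : {set 'I_n}), (2 <= #|tau| <= d.+1)%N ->
     distribution P (chi tau) = bernoulli_prob (p n #|tau|.-1)) /\
  mutually_independent
    [set i : {n : nat & {set 'I_n}} | (2 <= #|tagged i| <= d.+1)%N]
    (fun i => chi (tagged i)).

Definition random_hypergraph (n : nat) (w : T) : {set {set 'I_n}} :=
  [set tau : {set 'I_n} | (2 <= #|tau| <= d.+1)%N && chi tau w]%SET.

Definition random_lower (n : nat) (w : T) : {set {set 'I_n}} :=
  lower_model d (random_hypergraph n w).

Definition random_upper (n : nat) (w : T) : {set {set 'I_n}} :=
  upper_model (random_hypergraph n w).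

End random_complexes.

(* Main.v *)
Require Import Defs.
From mathcomp Require Import ring lra zify.

(** Both parts are a first-moment bound followed by the convergence half of
    Borel-Cantelli; they differ only in which hyperedges make a (d-1)-cell
    non-maximal.

    Fix a set s of d vertices.  A vertex v outside s makes s non-maximal as
    soon as v |: s is a cell, and given that s is a cell this follows when
    v |: t is a hyperedge for each t in a suitable family F s of nonempty
    subsets of s: all of them in the lower model, and s alone in the upper
    model.  For distinct v these events depend on disjoint sets of hyperedges,
    hence are independent, and each has probability the product of the p_|t|
    over t in F s.  So s is a maximal cell with probability at most
      (1 - prod_(t in F s) p_|t|)^(n-d)  (probability_never_completed),
    and if that product is at least c p_d, the expected number of maximal
    cells is at most
      n^d exp(- c p_d)^(n-d)  (probability_some_never_completed).
    Since p_d dominates log n / n, the exponent c p_d (n-d) is eventually at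
    least (d+2) log n, so this is at most n^-2 (dominates_ln_near), a summable
    bound; almost surely there are therefore no maximal cells for n large
    (ae_no_maximal_cells).

    In the upper model c = 1.  In the lower model, p_1, ..., p_(d-1) are
    eventually at least some e in (0, 1], so among the at most 2^d factors all
    but the one for t = s are at least e, and c = e^(2^d) works. *)

Set Implicit Arguments.
Unset Strict Implicit.
Unset Printing Implicit Defensive.

Import Order.TTheory GRing.Theory Num.Theory.
Import numFieldNormedType.Exports.

Local Open Scope classical_set_scope.
Local Open Scope ring_scope.

(** * Independence and Borel-Cantelli *)

Section probability.
Context (disp : measure_display) (T : measurableType disp) (R : realType).
Variable P : probability T R.

(** The complements of independent events are independent.  The induction
    exchanges complements for events one at a time, by
    P (A `\` E) = P A - P (A `&` E), so it runs over intersections that mix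
    complements of some of the events with others of the events. *)
Lemma probability_bigcap_setC (V : eqType) (E : V -> set T) (q : V -> R)
    (s : seq V) :
  (forall v, measurable (E v)) -> uniq s ->
  (forall u, uniq u -> {subset u <= s} ->
    P (\big[setI/setT]_(v <- u) E v) = (\prod_(v <- u) q v)%:E) ->
  P (\big[setI/setT]_(v <- s) ~` E v) = (\prod_(v <- s) (1 - q v))%:E.
Proof.
move=> mE us indep.
suff H r u : uniq (r ++ u) -> {subset r ++ u <= s} ->
    P (\big[setI/setT]_(v <- r) ~` E v `&` \big[setI/setT]_(v <- u) E v) =
    (\prod_(v <- r) (1 - q v) * \prod_(v <- u) q v)%:E.
  have := H s [::]; rewrite cats0 !big_nil setIT mulr1; exact.
elim: r u => [u uu su|a r IHr u uru sru].
  by rewrite !big_nil setTI mul1r; exact: indep.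
set A := \big[setI/setT]_(v <- r) ~` E v.
have mA : measurable A by apply: bigsetI_measurable => v _; exact: measurableC.
set B := \big[setI/setT]_(v <- u) E v.
have mB : measurable B by apply: bigsetI_measurable.
have -> : \big[setI/setT]_(v <- a :: r) ~` E v `&` B = (A `&` B) `\` E a.
  by rewrite big_cons setDE -/A -setIA [LHS]setIC.
have perm_ru : perm_eq (r ++ a :: u) ((a :: r) ++ u).
  by rewrite perm_sym (perm_catCA [:: a] r u).
rewrite measureD ?probability_fin_num//; last 2 first.
- exact: measurableI.
- by rewrite ltey_eq fin_num_measure//; exact: measurableI.
have -> : A `&` B `&` E a = A `&` \big[setI/setT]_(v <- a :: u) E v.
  by rewrite big_cons -setIA [B `&` _]setIC.
have uru' : uniq (r ++ u) by move: uru => /=/andP[].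
pose p := \prod_(v <- r) (1 - q v).
transitivity ((p * \prod_(v <- u) q v)%:E -
              (p * \prod_(v <- a :: u) q v)%:E)%E; last first.
  by rewrite /p !big_cons -EFinB; congr EFin; ring.
apply: (congr2 (fun x y => x - y)%E); apply: IHr => //.
- by move=> v vru; apply: sru; rewrite inE vru orbT.
- by rewrite (perm_uniq perm_ru).
- by move=> v; rewrite (perm_mem perm_ru); exact: sru.
Qed.

(** Summability of 1/n^2 comes from the telescoping bound
    1/(k+2)^2 <= 1/(k+1) - 1/(k+2); shifting the sequence by N.+2 skips the
    terms where the hypothesis is not yet in force and gives room for it. *)
Lemma borel_cantelli_inv_sqr (A : (set T)^nat) :
  (forall n, measurable (A n)) ->
  (\forall n \near \oo, (P (A n) <= (n%:R ^- 2)%:E)%E) ->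
  {ae P, forall w, \forall n \near \oo, ~ A n w}.
Proof.
move=> mA [N _ PA].
pose G n := A (n + N.+2)%N.
have G0 : P (lim_sup_set G) = 0%E.
  apply: lim_sup_set_cvg0 => [k|]; first exact: mA.
  apply: (@le_lt_trans _ _ 1%E); last exact: ltry.
  apply: lime_le; first by apply: is_cvg_nneseries.
  apply: nearW => n.
  apply: (@le_trans _ _ (1 - n.+1%:R^-1)%:E); last first.
    by rewrite lee_fin gerBl invr_ge0.
  elim: n => [|n IHn]; first by rewrite big_geq// lee_fin invr1 subrr.
  rewrite big_nat_recr//=; apply: (le_trans (leeD IHn (PA _ _))).
    by rewrite /=; lia.
  rewrite -EFinD lee_fin.
  have h : ((n + N.+2)%:R ^- 2 : R) <= n.+1%:R^-1 * n.+2%:R^-1.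
    rewrite -invfM lef_pV2 ?posrE ?exprn_gt0 ?mulr_gt0// ?ltr0n ?addnS//.
    by rewrite -natrM -natrX ler_nat -mulnn leq_mul//; lia.
  apply: (le_trans (lerD (lexx _) h)).
  suff -> : n.+1%:R^-1 * n.+2%:R^-1 = n.+1%:R^-1 - n.+2%:R^-1 :> R.
    by rewrite addrA subrK.
  have n0 : 0 <= n%:R :> R by [].
  by field; rewrite !lt0r_neq0//; lra.
exists (lim_sup_set G); split => //.
  by apply: bigcapT_measurable => k; apply: bigcup_measurable => j _; exact: mA.
move=> w /= nA n _; apply: contrapT => nG; apply: nA.
exists (n + N.+2)%N => // k /= nk Akw; apply: nG.
exists (k - N.+2)%N; first by rewrite /= leq_subRL; lia.
by rewrite /G subnK//; lia.
Qed.

End probability.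

(** * Asymptotics of the parameters *)

Section asymptotics.
Variable R : realType.

Lemma liminf_gt0_near (u : nat -> R) :
  (0 < limn_einf (fun n => (u n)%:E))%E ->
  exists2 e, 0 < e & \forall n \near \oo, e <= u n.
Proof.
rewrite limn_einf_lim => l0.
have cvu : cvgn (einfs (fun n => (u n)%:E)) by exact: is_cvg_einfs.
have [e e0 el] : exists2 e : R, 0 < e &
    (e%:E < limn (einfs (fun n => (u n)%:E)))%E.
  move: l0; case: (limn _) => [r| |] //.
    rewrite lte_fin => r0; exists (r / 2); first by rewrite divr_gt0.
    by rewrite lte_fin; lra.
  by move=> _; exists 1 => //; exact: ltry.
exists e => //.
have : \forall n \near \oo, (e%:E < einfs (fun n => (u n)%:E) n)%E.
  apply: (cvu [set x | (e%:E < x)%E]); apply: open_nbhs_nbhs; split => //.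
  exact: open_ereal_gt_ereal.
apply: filterS => n /ltW en; rewrite -lee_fin.
apply: le_trans en _; apply: ereal_inf_lbound; exists n => //=.
Qed.

Lemma liminf_gt0_near_unif (u : nat -> nat -> R) (m : nat) :
  (0 < \big[Order.min/+oo]_(1 <= i < m) limn_einf (fun n => (u n i)%:E))%E ->
  exists2 e, 0 < e <= 1 &
    \forall n \near \oo, forall i, (1 <= i < m)%N -> e <= u n i.
Proof.
elim: m => [|m IHm].
  move=> _; exists 1; first by rewrite ltr01 lexx.
  by apply: nearW => n i; rewrite ltn0 andbF.
have [->|m0] := posnP m.
  move=> _; exists 1; first by rewrite ltr01 lexx.
  by apply: nearW => n i; lia.
rewrite big_nat_recr//= lt_min => /andP[/IHm[e /andP[e0 e1] eu]].
move=> /liminf_gt0_near[e' e'0 e'u].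
exists (Num.min e e'); first by rewrite lt_min e0 e'0 ge_min e1.
near=> n => i /andP[i1]; rewrite ltnS leq_eqVlt => /orP[/eqP->|im].
  by rewrite ge_min; apply/orP; right; near: n.
rewrite ge_min; apply/orP; left.
have /(_ i) : forall i, (1 <= i < m)%N -> e <= u n i by near: n.
by apply; rewrite i1.
Unshelve. all: by end_near. Qed.

(** With f n >= 2 (d+2) ln n / (c n) and n - d >= n/2, the exponent
    c f(n) (n-d) is at least (d+2) ln n, which turns the factor n^d into
    n^(-2). *)
Lemma dominates_ln_near (f : nat -> R) (d : nat) (c : R) :
  0 < c -> (forall n, 0 < f n) ->
  dominates f (fun n => ln n%:R / n%:R) ->
  \forall n \near \oo,
    n%:R ^+ d * expR (- (c * f n)) ^+ (n - d) <= n%:R ^- 2 :> R.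
Proof.
move=> c0 f0 /cvgr0_norm_lt domf.
have e0 : 0 < c / (2 * d.+2%:R) by rewrite divr_gt0 ?mulr_gt0.
have {domf e0} := domf _ e0; move=> domf.
near=> n.
have n2d : (d.*2 <= n)%N by near: n; exact: nbhs_infty_ge.
have n0 : (0 < n)%N by near: n; exact: nbhs_infty_ge.
have n0R : 0 < n%:R :> R by rewrite ltr0n.
have : `|ln n%:R / n%:R / f n| < c / (2 * d.+2%:R) by near: n.
move/(le_lt_trans (ler_norm _)).
rewrite ltr_pdivrMr// ltr_pdivrMr// => ln_lt.
have lnX : n%:R ^+ d.+2 <= expR (c * f n) ^+ (n - d).
  rewrite -[X in X ^+ d.+2](lnK n0R) -!expRM_natl ler_expR.
  have nd : n%:R / 2 <= (n - d)%:R :> R.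
    by rewrite ler_pdivrMr// -natrM ler_nat; lia.
  apply: (@le_trans _ _ (n%:R / 2 * (c * f n))); last first.
    by rewrite ler_wpM2r// mulr_ge0// ltW.
  rewrite mulrC -ler_pdivlMr//; apply: (le_trans (ltW ln_lt)).
  by rewrite le_eqVlt; apply/orP; left; apply/eqP; field; rewrite ?pnatr_eq0//.
rewrite expRN exprVn ler_pdivrMr ?exprn_gt0 ?expR_gt0//.
by rewrite ler_pdivlMl ?exprn_gt0// -exprD.
Unshelve. all: by end_near. Qed.

End asymptotics.

(** * Completing a cell by one more vertex *)

Lemma setU1_outside_inj (V : finType) (s t t' : {set V}) (v v' : V) :
  v \notin s -> v' \notin s -> t \subset s -> t' \subset s ->
  (v |: t = v' |: t')%SET -> (v, t) = (v', t').
Proof.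
move=> vs v's ts t's e.
have H u (r : {set V}) : u \notin s -> r \subset s ->
    (((u |: r) :\: s)%SET = [set u]%SET) /\ (((u |: r) :&: s)%SET = r).
  move=> us rs; split; apply/setP => x; rewrite !inE.
    have [->|xu] := eqVneq x u; first by rewrite us.
    by case: (boolP (x \in r)) => [/(fintype.subsetP rs) ->|]; rewrite ?andbF.
  have [->|xu] := eqVneq x u.
    by rewrite (negbTE us) andbF (contraNF (fintype.subsetP rs u)).
  by case: (boolP (x \in r)) => [/(fintype.subsetP rs) ->|].
have [e1 e2] := H _ _ vs ts; have [e1' e2'] := H _ _ v's t's.
rewrite -e2 -e2' -e; congr pair; apply/set1_inj.
by rewrite -e1 -e1' e.
Qed.

Lemma leq_bin_exp n m : ('C(n, m) <= n ^ m)%N.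
Proof.
apply: (@leq_trans (n ^_ m)); first by rewrite -bin_ffact leq_pmulr ?fact_gt0.
elim: m => [|m IHm]; first by rewrite ffactn0.
by rewrite ffactnSr expnSr leq_mul// leq_subr.
Qed.

Section completion.
Context (disp : measure_display) (T : measurableType disp) (R : realType).
Variables (P : probability T R) (d : nat) (p : nat -> nat -> R).
Variable chi : forall n, {set 'I_n} -> {RV P >-> bool}.
Hypothesis p01 : forall n k, (1 <= k <= d)%N -> 0 < p n k <= 1.
Hypothesis chi_bernoulli : bernoulli_array d chi p.

Definition hyperedge_event n (t : {set 'I_n}) : set T := chi t @^-1` [set true].

Lemma measurable_hyperedge n (t : {set 'I_n}) : measurable (hyperedge_event t).
Proof. by rewrite -[X in measurable X]setTI; exact: measurable_funP. Qed.

Lemma probability_hyperedges n (L : seq {set 'I_n}) :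
  uniq L -> {in L, forall t : {set 'I_n}, (2 <= #|t| <= d.+1)%N} ->
  P (\big[setI/setT]_(t <- L) hyperedge_event t) =
  (\prod_(t <- L) p n #|t|.-1)%:E.
Proof.
move=> uL szL; case: chi_bernoulli => distr indep.
pose M := [seq existT (fun m => {set 'I_m}) n t | t <- L].
have uM : uniq M.
  by rewrite map_inj_uniq// => s t /eqP; rewrite eq_Tagged => /eqP.
pose D := seq_fset tt M.
have permD : perm_eq D M by rewrite -[X in perm_eq _ X]undup_id// seq_fset_perm.
have DM i : (i \in D) = (i \in M) by rewrite (perm_mem permD).
have := indep D (fun=> [set true]); rewrite bigcap_fset !(perm_big _ permD)/=.
rewrite !big_map => -> //; last first.
  by move=> i /=; rewrite DM => /mapP[t tL ->] /=; exact: szL.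
rewrite -prodEFin big_seq [RHS]big_seq; apply: eq_bigr => t tL.
have pt : 0 < p n #|t|.-1 <= 1 by apply: p01; have := szL _ tL; lia.
transitivity (distribution P (chi t) [set true]) => //.
rewrite distr ?szL// bernoulli_probE; last by case/andP: pt => /ltW -> ->.
by rewrite !diracE mem_set//= memNset//= mule1 mule0 adde0.
Qed.

(** When s is a cell and F is its completing family, this event puts v |: s
    in the complex. *)
Definition completed_by n (F : {set {set 'I_n}}) (v : 'I_n) : set T :=
  \big[setI/setT]_(t <- enum F) hyperedge_event (v |: t).

Lemma measurable_completed_by n (F : {set {set 'I_n}}) v :
  measurable (completed_by F v).
Proof. by apply: bigsetI_measurable => t _; exact: measurable_hyperedge. Qed.

Definition never_completed n (s : {set 'I_n}) (F : {set {set 'I_n}}) : set T :=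
  \big[setI/setT]_(v <- enum (~: s)) ~` completed_by F v.

Lemma measurable_never_completed n (s : {set 'I_n}) F :
  measurable (never_completed s F).
Proof.
apply: bigsetI_measurable => v _; apply: measurableC.
exact: measurable_completed_by.
Qed.

Lemma never_completedP n (s : {set 'I_n}) (F : {set {set 'I_n}}) w :
  (forall v, v \notin s -> exists2 t, t \in F & ~~ chi (v |: t) w) ->
  never_completed s F w.
Proof.
move=> H; rewrite /never_completed -bigcap_seq => v /=.
rewrite mem_enum inE => /H[t tF /negP nt].
rewrite /completed_by -bigcap_seq => /(_ t) /=.
by rewrite mem_enum => /(_ tF).
Qed.

(** For v outside s and t inside s, v and t are determined by v |: t.  So the
    events completed_by F v, for distinct v, involve disjoint sets of
    hyperedges and are independent. *)
Lemma probability_never_completed n (s : {set 'I_n}) (F : {set {set 'I_n}}) :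
  (#|s| <= d)%N -> (forall t, t \in F -> t \subset s /\ (0 < #|t|)%N) ->
  P (never_completed s F) =
  ((1 - \prod_(t in F) p n #|t|) ^+ (n - #|s|))%:E.
Proof.
move=> sd Fs.
rewrite (@probability_bigcap_setC _ _ _ _ _ _
  (fun=> \prod_(t in F) p n #|t|)) ?enum_uniq//; last 2 first.
- by move=> v; exact: measurable_completed_by.
- move=> u uu us; rewrite /completed_by.
  have us' v : v \in u -> v \notin s by move=> /us; rewrite mem_enum inE.
  have cardvt v t : v \in u -> t \in F -> #|v |: t| = #|t|.+1.
    move=> /us' vs /Fs[ts _]; rewrite cardsU1.
    by rewrite (contra (fintype.subsetP ts v) vs).
  pose L := [seq v |: t | v <- u, t <- enum F].
  have uL : uniq L.
    apply: allpairs_uniq; rewrite ?enum_uniq//.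
    move=> x y /allpairsP[[v t] /= [/us' vs tF ->]].
    move=> /allpairsP[[v' t'] /= [/us' v's t'F ->]].
    move: tF t'F; rewrite !mem_enum => /Fs[ts _] /Fs[t's _].
    exact: (setU1_outside_inj vs v's ts t's).
  have := @probability_hyperedges n L uL.
  rewrite /L !big_allpairs_dep => ->.
    congr EFin; apply: eq_big_seq => v vu.
    rewrite big_enum/=; apply: eq_bigr => t tF.
    by rewrite (cardvt _ _ vu tF).
  move=> _ /allpairsP[[v t] /= [vu + ->]]; rewrite mem_enum => tF.
  have [ts t0] := Fs _ tF; rewrite (cardvt _ _ vu tF).
  by move: t0; have := subset_leq_card ts; lia.
by rewrite big_enum prodr_const cardsCs finset.setCK card_ord.
Qed.

Definition some_never_completed n (F : {set 'I_n} -> {set {set 'I_n}}) :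
    set T :=
  \big[setU/set0]_(s : {set 'I_n} | #|s| == d) never_completed s (F s).

Lemma measurable_some_never_completed n (F : {set 'I_n} -> {set {set 'I_n}}) :
  measurable (some_never_completed F).
Proof.
by apply: bigsetU_measurable => s _; exact: measurable_never_completed.
Qed.

(** Union bound over the at most n^d sets of d vertices, with
    1 - q <= exp(- q). *)
Lemma probability_some_never_completed n (F : {set 'I_n} -> {set {set 'I_n}})
    (q : R) :
  (forall s t : {set 'I_n}, #|s| = d -> t \in F s ->
    t \subset s /\ (0 < #|t|)%N) ->
  (forall s : {set 'I_n}, #|s| = d -> q <= \prod_(t in F s) p n #|t|) ->
  (P (some_never_completed F) <= (n%:R ^+ d * expR (- q) ^+ (n - d))%:E)%E.
Proof.
move=> Fs Fq; set b := expR (- q) ^+ (n - d).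
have Pb (s : {set 'I_n}) : #|s| == d -> (P (never_completed s (F s)) <= b%:E)%E.
  move=> /eqP sd; have Fss t := Fs s t sd.
  rewrite probability_never_completed ?sd// lee_fin lerXn2r ?nnegrE ?expR_ge0//.
    rewrite subr_ge0; apply: prodr_ile1 => t /Fss[ts t0].
    have /andP[/ltW -> ->] // : 0 < p n #|t| <= 1.
    by apply: p01; rewrite t0 -sd subset_leq_card.
  by apply: le_trans (expR_ge1Dx (- q)); rewrite lerB// Fq.
apply: (@le_trans _ _ (\sum_(s : {set 'I_n} | #|s| == d) b%:E)%E).
  pose K (A : set T) (x : \bar R) := measurable A /\ (P A <= x)%E.
  have [] // : K (some_never_completed F)
                 (\sum_(s : {set 'I_n} | #|s| == d) b%:E)%E.
  apply: (big_ind2 K); first by split => //; rewrite measure0.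
    move=> A x B y [mA Ax] [mB By]; split; first exact: measurableU.
    exact: le_trans (measureU2 P mA mB) (leeD Ax By).
  by move=> s sd; split; [exact: measurable_never_completed|exact: Pb].
rewrite sumEFin lee_fin sumr_const -cardsE card_draws card_ord.
rewrite -[_ *+ _]mulr_natl.
by rewrite ler_wpM2r ?exprn_ge0 ?expR_ge0// -natrX ler_nat leq_bin_exp.
Qed.

(** The part of the argument common to both models: F n s is the family of
    subsets t of the cell s such that the hyperedges v |: t suffice to make
    v |: s a cell. *)
Lemma ae_no_maximal_cells (X : forall n, T -> {set {set 'I_n}})
    (F : forall n, {set 'I_n} -> {set {set 'I_n}}) (c : R) :
  (0 < d)%N -> 0 < c ->
  (forall n (s t : {set 'I_n}), #|s| = d -> t \in F n s ->
    t \subset s /\ (0 < #|t|)%N) ->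
  (forall n w (s : {set 'I_n}) v, s \in X n w -> #|s| = d -> v \notin s ->
    (forall t, t \in F n s -> chi (v |: t) w) -> (v |: s)%SET \in X n w) ->
  (\forall n \near \oo, forall s : {set 'I_n}, #|s| = d ->
    c * p n d <= \prod_(t in F n s) p n #|t|) ->
  dominates (fun n => p n d) (fun n => ln n%:R / n%:R) ->
  {ae P, forall w,
    (num_maximal_cells d.-1 (X n w))%:R @[n --> \oo] --> (0 : R)}.
Proof.
move=> d0 c0 Fs FX Fc dom.
have pd0 n : 0 < p n d by have /andP[] : 0 < p n d <= 1 by apply: p01; lia.
have : \forall n \near \oo,
    (P (some_never_completed (F n)) <= (n%:R ^- 2)%:E)%E.
  have near_bound := dominates_ln_near d c0 pd0 dom.
  near=> n.
  have Fcn : forall s : {set 'I_n}, #|s| = d ->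
    c * p n d <= \prod_(t in F n s) p n #|t| by near: n.
  apply: (le_trans (probability_some_never_completed (Fs n) Fcn)).
  by rewrite lee_fin; near: n.
move=> /borel_cantelli_inv_sqr.
move=> /(_ (fun n => measurable_some_never_completed (F n))).
apply: filterS => w nbad; apply: cvg_near_cst; apply: filterS nbad.
move=> n nbad; apply/eqP; rewrite pnatr_eq0 cards_eq0.
apply/eqP/setP => s; rewrite [RHS]inE; apply/negbTE/negP.
rewrite !inE (prednK d0) => /andP[/andP[sX /eqP sd] /forall_inP smax].
apply: nbad; rewrite /some_never_completed -bigcup_seq_cond.
exists s; first by rewrite /= mem_index_enum sd eqxx.
apply: never_completedP => v vs; apply: contrapT => nt.
have vsX : (v |: s)%SET \in X n w.
  apply: FX => // t tF; apply: contrapT => /negP chit.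
  by apply: nt; exists t.
have /smax/negP : (v |: s)%SET \in cells d (X n w).
  by rewrite inE vsX cardsU1 vs sd eqxx.
by apply; exact: finset.subsetUr.
Unshelve. all: by end_near. Qed.

End completion.

(** * The two models *)

(** A subset of v |: s with at least two elements either lies inside the cell
    s, or is v |: t with t a nonempty subset of s. *)
Lemma lower_model_extend (V : finType) (d : nat) (H : {set {set V}})
    (s : {set V}) (v : V) :
  #|s| = d -> v \notin s -> s \in lower_model d H ->
  (forall t : {set V}, t \subset s -> (0 < #|t|)%N -> (v |: t)%SET \in H) ->
  (v |: s)%SET \in lower_model d H.
Proof.
move=> sd vs; rewrite inE => /andP[_ /forallP sH] vH.
rewrite inE cardsU1 vs sd add1n leqnn /=.
apply/forallP => t; apply/implyP => /andP[ts t2].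
have [vt|vt] := boolP (v \in t).
  rewrite -(finset.setD1K vt); apply: vH.
    apply/fintype.subsetP => x /setD1P[xv] /(fintype.subsetP ts).
    by case/setU1P => [/eqP|//]; rewrite (negbTE xv).
  by move: t2; rewrite (cardsD1 v) vt.
apply: (implyP (sH t)); rewrite t2 andbT; apply/fintype.subsetP => x xt.
have /setU1P[xv|//] := fintype.subsetP ts _ xt.
by rewrite -xv xt in vt.
Qed.

(** Every proper nonempty subset of s contributes a factor at least e, and s
    itself contributes q #|s|, which may be arbitrarily small. *)
Lemma expr_le_prod_powerset (R : realType) (V : finType) (s : {set V})
    (q : nat -> R) (e : R) :
  (0 < #|s|)%N -> 0 < e <= 1 -> 0 <= q #|s| ->
  (forall i, (1 <= i < #|s|)%N -> e <= q i) ->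
  e ^+ (2 ^ #|s|) * q #|s| <= \prod_(t in powerset s :\ finset.set0) q #|t|.
Proof.
move=> s0 /andP[e0 e1] qs qe.
rewrite (bigD1 s)/=; last by rewrite !inE subxx andbT -card_gt0.
rewrite mulrC ler_wpM2l//.
apply: (@le_trans _ _
  (\prod_(t in powerset s :\ finset.set0 | t != s) e)).
  rewrite prodr_const ler_wiXn2l//; first exact: ltW.
  rewrite -card_powerset; apply/subset_leq_card/fintype.subsetP => t.
  by rewrite unfold_in !inE => /andP[/andP[]].
apply: ler_prod => t /andP[]; rewrite !inE => /andP[t0 ts] tns.
rewrite (ltW e0) qe// card_gt0 t0 proper_card//.
by rewrite finset.properEneq tns.
Qed.

Theorem theorem7 (disp : measure_display) (T : measurableType disp)
    (R : realType) (P : probability T R) (d : nat) (p : nat -> nat -> R)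
    (chi : forall n, {set 'I_n} -> {RV P >-> bool})
    (d_ge2 : (2 <= d)%N)
    (p01 : forall n k, (1 <= k <= d)%N -> 0 < p n k <= 1)
    (chi_bernoulli : bernoulli_array d chi p) :
  ((0 < \big[Order.min/+oo]_(1 <= i < d) limn_einf (fun n => (p n i)%:E))%E ->
   dominates (fun n => p n d) (fun n => ln n%:R / n%:R) ->
   {ae P, forall w,
     (num_maximal_cells d.-1 (random_lower d chi n w))%:R
       @[n --> \oo] --> (0 : R)}) /\
  (dominates (fun n => p n d) (fun n => ln n%:R / n%:R) ->
   {ae P, forall w,
     (num_maximal_cells d.-1 (random_upper d chi n w))%:R
       @[n --> \oo] --> (0 : R)}).
Proof.
have d0 : (0 < d)%N by exact: ltnW.
split=> [/liminf_gt0_near_unif[e e01 pe]|] dom.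
  apply: (@ae_no_maximal_cells _ _ _ _ _ p chi p01 chi_bernoulli _
    (fun n s => powerset s :\ finset.set0)%SET (e ^+ (2 ^ d))) => //.
  - by rewrite exprn_gt0//; case/andP: e01.
  - by move=> n s t sd; rewrite !inE -card_gt0 => /andP[].
  - move=> n w s v sX sd vs vt; apply: lower_model_extend => // t ts t0.
    rewrite inE vt ?andbT; last by rewrite !inE -card_gt0 t0.
    have vnt : v \notin t by exact: contra (fintype.subsetP ts v) vs.
    by rewrite cardsU1 vnt; have := subset_leq_card ts; lia.
  - apply: filterS pe => n pe s sd; rewrite -sd.
    apply: (expr_le_prod_powerset (q := p n)); rewrite ?sd//.
    by have /andP[/ltW] : 0 < p n d <= 1 by apply: p01; rewrite d0 leqnn.
apply: (@ae_no_maximal_cells _ _ _ _ _ p chi p01 chi_bernoulli _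
  (fun n s => [set s])%SET 1) => //.
- by move=> n s t sd; rewrite inE => /eqP ->; rewrite sd.
- move=> n w s v sX sd vs vt.
  apply/bigcupP; exists (v |: s)%SET; last by rewrite powersetE.
  by rewrite inE vt ?set11// cardsU1 vs sd; lia.
- by apply: nearW => n s sd; rewrite big_set1 sd mul1r.
Qed.
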